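(* Let $S$ be a reduced local ring that is module-finite over a regular local ring $R$ of characteristic $p>0$. Then the minimal perfect $S$-algebra $S_\infty$ is an almost flat $R_\infty$-module.
   Context: Local rings are Noetherian. For a reduced Noetherian ring $S$ of characteristic $p>0$ with total ring of fractions $\prod_{i=1}^n K_i$ (a finite product of fields) and algebraic closures $\overline K_i$, put $S_n:=S^{p^{-n}}\subseteq\prod_i\overline K_i$ (the ring of $p^n$-th roots of elements of $S$) and $S_\infty:=\bigcup_{n>0}S_n$, the minimal perfect closure of $S$ (minimal perfect $S$-algebra); for a domain this is the usual perfect closure. $S_\infty$ is an $R_\infty$-module via the map $R_\infty\to S_\infty$ induced by $R\to S$. The algebra $R_\infty$ is assumed to be equipped with a value map $v$, with respect to which ''almost'' is understood. A value map on a commutative ring $T$ is a map $v:T\to\mathbb R\cup\{\infty\}$ with $v(ab)=v(a)+v(b)$ and $v(a+b)\ge\min\{v(a),v(b)\}$ for all $a,b\in T$, and $v(a)=\infty$ if $a=0$. A $T$-module $M$ is almost zero (written $M\approx0$) if for every $m\in M$ and every $\epsilon>0$ there is $b\in T$ with $bm=0$ and $v(b)<\epsilon$. A $T$-module $M$ is almost flat if $\operatorname{Tor}_i^T(M,N)\approx 0$ for all $i>0$ and all $T$-modules $N$.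
   Formalization: The value map v is required to satisfy v(a)=∞ if and only if a=0, not just v(a)=∞ if a=0; otherwise v constantly ∞ would be a value map, for which not even the zero module is almost zero, and the claim would fail. *)

(* Defs.v *)
From HB Require Import structures.
From mathcomp Require Import all_boot all_order all_algebra.
From mathcomp Require Import freeg boolp constructive_ereal reals.

Set Implicit Arguments.
Unset Strict Implicit.
Unset Printing Implicit Defensive.

Import Order.TTheory GRing.Theory Num.Theory.

Local Open Scope ring_scope.
Local Open Scope quotient_scope.

(* The library's [idealr_closed I] includes [1 \notin I], i.e. it means that
   [I] is a proper ideal.  Ideals are boolean predicates; under the classical
   axioms of [boolp] every subset is given by such a predicate. *)
Section LocalRings.
Variable A : comNzRingType.
Implicit Types I J m : {pred A}.

Definition generates (s : seq A) I :=
  forall x, x \in I <->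
    exists c : 'I_(size s) -> A, x = \sum_(i < size s) c i * s`_i.

(* The unit ideal is always finitely generated, so quantifying over proper
   ideals is enough. *)
Definition noetherian := forall I, idealr_closed I -> exists s, generates s I.

Definition maximal_ideal m :=
  idealr_closed m /\
  forall J, idealr_closed J -> {subset m <= J} -> {subset J <= m}.

Definition local_ring :=
  noetherian /\
  exists2 m, maximal_ideal m & forall m', maximal_ideal m' -> m' =i m.

Definition prime_ideal I := idealr_closed I /\ prime_idealr_closed I.

Definition prime_chain (d : nat) (P : nat -> {pred A}) :=
  (forall i, (i <= d)%N -> prime_ideal (P i)) /\
  (forall i, (i < d)%N ->
     {subset P i <= P i.+1} /\ ~ {subset P i.+1 <= P i}).

Definition has_krull_dim (d : nat) :=
  (exists P, prime_chain d P) /\ (forall P, ~ prime_chain d.+1 P).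

Definition regular_local_ring :=
  local_ring /\
  exists m s, [/\ maximal_ideal m, generates s m & has_krull_dim (size s)].

Definition reduced_ring := forall (x : A) n, x ^+ n = 0 -> x = 0.

End LocalRings.

Definition module_finite (A B : comNzRingType) (f : {rmorphism A -> B}) :=
  exists s : seq B, forall y : B,
    exists c : 'I_(size s) -> A, y = \sum_(i < size s) f (c i) * s`_i.

(* The total ring of fractions of [A], presented as a finite product of fields
   [K i], together with an algebraic closure [L i] of each of them.  As [A] is
   not the zero ring there is at least one factor. *)
Record frac_closure (A : comNzRingType) := FracClosure {
  fc_pred : nat;
  fc_K : 'I_fc_pred.+1 -> fieldType;
  fc_L : 'I_fc_pred.+1 -> closedFieldType;
  fc_loc : forall i, {rmorphism A -> fc_K i};
  fc_emb : forall i, {rmorphism fc_K i -> fc_L i};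
  fc_inj : forall a, (forall i, fc_loc i a = 0) -> a = 0;
  fc_unit : forall a, GRing.lreg a -> forall i, fc_loc i a != 0;
  fc_frac : forall x : (forall i, fc_K i), exists a b,
    GRing.lreg b /\ forall i, x i = fc_loc i a / fc_loc i b;
  fc_alg : forall i (z : fc_L i), algebraicOver (fc_emb i) z
}.

Section ProdRing.
Variables (n : nat) (L : 'I_n.+1 -> closedFieldType).

Definition prodL : Type := forall i, L i.

HB.instance Definition _ := gen_eqMixin prodL.
HB.instance Definition _ := gen_choiceMixin prodL.

Let prodLP (x y : prodL) : (forall i, x i = y i) -> x = y.
Proof. by move=> xy; apply: functional_extensionality_dep. Qed.

Let zero : prodL := fun i => 0.
Let opp (x : prodL) : prodL := fun i => - x i.
Let add (x y : prodL) : prodL := fun i => x i + y i.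
Let one : prodL := fun i => 1.
Let mul (x y : prodL) : prodL := fun i => x i * y i.

Let addA : associative add.
Proof. by move=> x y z; apply: prodLP => i; rewrite /add addrA. Qed.
Let addC : commutative add.
Proof. by move=> x y; apply: prodLP => i; rewrite /add addrC. Qed.
Let add0 : left_id zero add.
Proof. by move=> x; apply: prodLP => i; rewrite /add add0r. Qed.
Let addN : left_inverse zero opp add.
Proof. by move=> x; apply: prodLP => i; rewrite /add /opp addNr. Qed.
HB.instance Definition _ := GRing.isZmodule.Build prodL addA addC add0 addN.

Let mulA : associative mul.
Proof. by move=> x y z; apply: prodLP => i; rewrite /mul mulrA. Qed.
Let mulC : commutative mul.
Proof. by move=> x y; apply: prodLP => i; rewrite /mul mulrC. Qed.
Let mul1 : left_id one mul.
Proof. by move=> x; apply: prodLP => i; rewrite /mul mul1r. Qed.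
Let mulD : left_distributive mul +%R.
Proof. by move=> x y z; apply: prodLP => i; apply: mulrDl. Qed.
Let one_neq0 : one != 0.
Proof.
apply/eqP => /(congr1 (fun x : prodL => x ord0)) /eqP.
by rewrite /one (oner_eq0 (L ord0)).
Qed.
HB.instance Definition _ :=
  GRing.Zmodule_isComNzRing.Build prodL mulA mulC mul1 mulD one_neq0.

Lemma prodL_ext (x y : prodL) : (forall i, x i = y i) -> x = y.
Proof. exact: prodLP. Qed.

Lemma prodL_exp (x : prodL) k i : (x ^+ k) i = x i ^+ k.
Proof. by elim: k => // k IH; rewrite !exprS -IH. Qed.

End ProdRing.

Section FracEmb.
Variables (A : comNzRingType) (C : frac_closure A).

Definition frac_emb (a : A) : prodL (@fc_L A C) :=
  fun i => fc_emb i (fc_loc i a).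

Let frac_emb_zmod : zmod_morphism frac_emb.
Proof. by move=> a b; apply: prodL_ext => i; rewrite /frac_emb !rmorphB. Qed.
Let frac_emb_monoid : monoid_morphism frac_emb.
Proof.
split=> [|a b]; apply: prodL_ext => i; rewrite /frac_emb ?rmorph1 //.
by rewrite !rmorphM.
Qed.
HB.instance Definition _ :=
  GRing.isZmodMorphism.Build A (prodL (@fc_L A C)) frac_emb frac_emb_zmod.
HB.instance Definition _ :=
  GRing.isMonoidMorphism.Build A (prodL (@fc_L A C)) frac_emb frac_emb_monoid.

Lemma frac_emb_inj : injective frac_emb.
Proof.
move=> a b ab; apply/eqP; rewrite -subr_eq0; apply/eqP/(@fc_inj _ C) => i.
apply: (fmorph_inj (fc_emb i)); rewrite rmorph0 !rmorphB; apply/eqP.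
by rewrite subr_eq0; apply/eqP; apply: (congr1 (fun x : prodL _ => x i) ab).
Qed.

Definition is_root (p n : nat) (x : prodL (@fc_L A C)) :=
  exists a, x ^+ (p ^ n) = frac_emb a.

Lemma is_root_le p m n x : (m <= n)%N -> is_root p m x -> is_root p n x.
Proof.
move=> mn [a xa]; exists (a ^+ (p ^ (n - m))).
by rewrite rmorphXn /= -xa -exprM -expnD subnKC.
Qed.

End FracEmb.

Arguments frac_emb {A} C a : simpl never.

Section PerfectClosure.
Variables (p : nat) (A : comNzRingType).
Variables (charA : p \in [pchar A]) (C : frac_closure A).

Local Notation L := (prodL (@fc_L A C)).

Lemma pcharL : p \in [pchar L].
Proof. exact: (rmorph_pchar (frac_emb C) charA). Qed.

Lemma frobeniusB n (x y : L) : (x - y) ^+ (p ^ n) = x ^+ (p ^ n) - y ^+ (p ^ n).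
Proof.
have pn : [pchar L].-nat (p ^ n)%N.
  have pp := pcharf_prime pcharL.
  rewrite (eq_pnat _ (pcharf_eq pcharL)).
  by rewrite pnatX pnat_id.
by rewrite exprDn_pchar // exprNn_pchar.
Qed.

(* [charA] is only needed for this to be closed under subtraction. *)
Definition perf_pred of p \in [pchar A] : {pred L} :=
  fun x => `[< exists2 n, (0 < n)%N & is_root p n x >].

Let perf_subring : subring_closed (perf_pred charA).
Proof.
split.
- apply/asboolP; exists 1%N => //; exists 1; by rewrite expr1n rmorph1.
- move=> x y /asboolP[m m0 xm] /asboolP[n n0 yn]; apply/asboolP.
  exists (m + n)%N; first by rewrite addn_gt0 m0.
  have [a xa] := is_root_le (leq_addr n m) xm.
  have [b yb] := is_root_le (leq_addl m n) yn.
  by exists (a - b); rewrite frobeniusB xa yb rmorphB.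
- move=> x y /asboolP[m m0 xm] /asboolP[n n0 yn]; apply/asboolP.
  exists (m + n)%N; first by rewrite addn_gt0 m0.
  have [a xa] := is_root_le (leq_addr n m) xm.
  have [b yb] := is_root_le (leq_addl m n) yn.
  by exists (a * b); rewrite exprMn xa yb rmorphM.
Qed.
HB.instance Definition _ :=
  GRing.isSubringClosed.Build L (perf_pred charA) perf_subring.

Definition perfect_closure : Type := {x : L | x \in perf_pred charA}.

HB.instance Definition _ := [isSub of perfect_closure for @sval _ _].
HB.instance Definition _ := [Choice of perfect_closure by <:].
HB.instance Definition _ :=
  [SubChoice_isSubComNzRing of perfect_closure by <:].

Let perf_inj_subproof a : frac_emb C a \in perf_pred charA.
Proof.
by apply/asboolP; exists 1%N => //; exists (a ^+ (p ^ 1)); rewrite rmorphXn.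
Qed.

Definition perf_inj (a : A) : perfect_closure :=
  exist _ (frac_emb C a) (perf_inj_subproof a).

Let perf_inj_zmod : zmod_morphism perf_inj.
Proof. by move=> a b; apply: val_inj; rewrite rmorphB /= rmorphB. Qed.
Let perf_inj_monoid : monoid_morphism perf_inj.
Proof.
split=> [|a b]; apply: val_inj; first by rewrite rmorph1 /= rmorph1.
by rewrite rmorphM /= rmorphM.
Qed.
HB.instance Definition _ :=
  GRing.isZmodMorphism.Build A perfect_closure perf_inj perf_inj_zmod.
HB.instance Definition _ :=
  GRing.isMonoidMorphism.Build A perfect_closure perf_inj perf_inj_monoid.

Lemma perf_injP : injective perf_inj.
Proof. by move=> a b /(congr1 val) /(@frac_emb_inj _ _). Qed.

Lemma perf_frobeniusB n (x y : perfect_closure) :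
  (x - y) ^+ (p ^ n) = x ^+ (p ^ n) - y ^+ (p ^ n).
Proof.
by apply: val_inj; rewrite rmorphB !rmorphXn rmorphB; apply: frobeniusB.
Qed.

Lemma perf_frobenius_inj n : injective (fun x : perfect_closure => x ^+ (p ^ n)).
Proof.
move=> x y /= /(congr1 val); rewrite !rmorphXn => xy.
have /eqP := xy; rewrite -subr_eq0 -frobeniusB => /eqP xy0.
apply: val_inj; apply/eqP; rewrite -subr_eq0; apply/eqP; apply: prodL_ext => i.
have /eqP := congr1 (fun z : L => z i) xy0.
by rewrite prodL_exp expf_eq0 => /andP[_ /eqP].
Qed.

Lemma perf_root (x : perfect_closure) :
  exists n a, x ^+ (p ^ n) = perf_inj a.
Proof.
have /asboolP[n _ [a xa]] := valP x; exists n, a; apply: val_inj.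
by rewrite rmorphXn.
Qed.

Lemma perf_has_root n a : exists x : perfect_closure, x ^+ (p ^ n) = perf_inj a.
Proof.
have pp := pcharf_prime charA.
have rootL (F : closedFieldType) (c : F) : exists z, z ^+ (p ^ n) = c.
  have pn0 : (0 < p ^ n)%N by rewrite expn_gt0 prime_gt0.
  have [z zc] := solve_monicpoly (fun i => c *+ (i == 0)%N) pn0.
  exists z; rewrite zc -(prednK pn0) big_ord_recl /= expr0 mulr1 big1 ?addr0 //.
  by move=> i _; rewrite mul0r.
pose z : L := fun i => projT1 (cid (rootL _ (frac_emb C a i))).
have zE : z ^+ (p ^ n) = frac_emb C a.
  by apply: prodL_ext => i; rewrite prodL_exp /z; case: cid.
have zP : z \in perf_pred charA.
  apply/asboolP; exists n.+1 => //; apply: (@is_root_le _ _ _ n) => //.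
  by exists a.
by exists (exist _ z zP); apply: val_inj; rewrite rmorphXn.
Qed.

End PerfectClosure.

Section PerfectMap.
Variables (p : nat) (A B : comNzRingType) (f : {rmorphism A -> B}).
Variables (charA : p \in [pchar A]) (CA : frac_closure A) (CB : frac_closure B).

Let charB := rmorph_pchar f charA.
Local Notation Ainf := (perfect_closure charA CA).
Local Notation Binf := (perfect_closure charB CB).

Let rel (x : Ainf) (y : Binf) :=
  exists n a, x ^+ (p ^ n) = perf_inj charA CA a /\
              y ^+ (p ^ n) = perf_inj charB CB (f a).

Let rel_ex x : exists y, rel x y.
Proof.
have [n [a xa]] := perf_root x.
by have [y ya] := perf_has_root charB CB n (f a); exists y, n, a.
Qed.

Let rel_lift x y : rel x y -> exists n0, forall n, (n0 <= n)%N ->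
  exists a, x ^+ (p ^ n) = perf_inj charA CA a /\
            y ^+ (p ^ n) = perf_inj charB CB (f a).
Proof.
case=> n0 [a [xa ya]]; exists n0 => n le; exists (a ^+ (p ^ (n - n0))).
by rewrite !rmorphXn /= -xa -ya -!exprM -expnD subnKC.
Qed.

Let rel_lift2 x y x' y' : rel x y -> rel x' y' -> exists n a a',
  [/\ x ^+ (p ^ n) = perf_inj charA CA a,
      y ^+ (p ^ n) = perf_inj charB CB (f a),
      x' ^+ (p ^ n) = perf_inj charA CA a' &
      y' ^+ (p ^ n) = perf_inj charB CB (f a')].
Proof.
move=> /rel_lift[m hm] /rel_lift[m' hm']; exists (m + m')%N.
have [a [? ?]] := hm _ (leq_addr m' m).
by have [a' [? ?]] := hm' _ (leq_addl m m'); exists a, a'.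
Qed.

Let rel_uniq x y y' : rel x y -> rel x y' -> y = y'.
Proof.
move=> xy xy'; have [n [a [a' [xa ya xa' ya']]]] := rel_lift2 xy xy'.
apply: (@perf_frobenius_inj p B charB CB n) => /=.
rewrite ya ya'; congr (perf_inj _ _ (f _)).
by apply: (@perf_injP p A charA CA); rewrite -xa -xa'.
Qed.

Lemma perf_map_exists : exists g : {rmorphism Ainf -> Binf},
  forall a, g (perf_inj charA CA a) = perf_inj charB CB (f a).
Proof.
pose g x := projT1 (cid (rel_ex x)).
have gP x : rel x (g x) by rewrite /g; case: cid.
have g_zmod : zmod_morphism g.
  move=> x x'; apply: (rel_uniq (gP _)).
  have [n [a [a' [xa ya xa' ya']]]] := rel_lift2 (gP x) (gP x').
  exists n, (a - a'); rewrite !perf_frobeniusB xa xa' ya ya' !rmorphB; split; exact: erefl.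
have g_monoid : monoid_morphism g.
  split=> [|x x'].
    apply: (rel_uniq (gP _)); exists 0%N, 1.
    by rewrite !expr1n !rmorph1.
  apply: (rel_uniq (gP _)).
  have [n [a [a' [xa ya xa' ya']]]] := rel_lift2 (gP x) (gP x').
  by exists n, (a * a'); rewrite !exprMn xa xa' ya ya' !rmorphM.
pose gZ := GRing.isZmodMorphism.Build _ _ g g_zmod.
pose gM := GRing.isMonoidMorphism.Build _ _ g g_monoid.
pose gR : {rmorphism Ainf -> Binf} := HB.pack g gZ gM.
exists gR => a; apply: (rel_uniq (gP _)).
by exists 0%N, a; rewrite !expr1.
Qed.

(* The ring morphism of perfect closures induced by [f]; it is the only one
   that extends [f]. *)
Definition perf_map : {rmorphism Ainf -> Binf} := projT1 (cid perf_map_exists).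

Lemma perf_map_inj a : perf_map (perf_inj charA CA a) = perf_inj charB CB (f a).
Proof. by rewrite /perf_map; case: cid => g /= ->. Qed.

Lemma perf_map_uniq (g : {rmorphism Ainf -> Binf}) :
  (forall a, g (perf_inj charA CA a) = perf_inj charB CB (f a)) ->
  g =1 perf_map.
Proof.
move=> gE x; have [n [a xa]] := perf_root x.
apply: (@perf_frobenius_inj p B charB CB n) => /=.
by rewrite -!rmorphXn xa gE perf_map_inj.
Qed.

End PerfectMap.

(* [B] seen as an [A]-module through a ring morphism [f : A -> B]. *)
Section Restriction.
Variables (A B : comNzRingType) (f : {rmorphism A -> B}).

Definition as_module of {rmorphism A -> B} : Type := B.

HB.instance Definition _ := GRing.Zmodule.on (as_module f).

Let scale (a : A) (x : as_module f) : as_module f := f a * (x : B).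
Let scaleA a b v : scale a (scale b v) = scale (a * b) v.
Proof. by rewrite /scale rmorphM mulrA. Qed.
Let scale1 : left_id 1 scale.
Proof. by move=> v; rewrite /scale rmorph1 mul1r. Qed.
Let scaleDr : right_distributive scale +%R.
Proof. by move=> a u v; apply: mulrDr. Qed.
Let scaleDl v : {morph scale^~ v : a b / a + b}.
Proof. by move=> a b; rewrite /scale rmorphD; apply: mulrDl. Qed.
HB.instance Definition _ := GRing.Zmodule_isLmodule.Build A (as_module f)
  scaleA scale1 scaleDr scaleDl.

End Restriction.

Section Quotients.
Variables (T : comNzRingType) (V : lmodType T).

(* [Quotient.quot] wants a subgroup; [submodClosed] is about semimodules. *)
Definition submod_pred (W : submodClosed V) : {pred V} := W.
HB.instance Definition _ (W : submodClosed V) :=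
  GRing.isZmodClosed.Build V (submod_pred W)
    (GRing.submod_closedB (submodClosedP W)).

Definition quotmod (W : submodClosed V) : Type := Quotient.quot (submod_pred W).

Variable W : submodClosed V.

HB.instance Definition _ := GRing.Zmodule.on (quotmod W).

Definition quotmod_pi (v : V) : quotmod W := \pi_(Quotient.quot (submod_pred W)) v.
Definition quotmod_repr (x : quotmod W) : V := repr (x : Quotient.quot (submod_pred W)).

Lemma quotmod_reprK : cancel quotmod_repr quotmod_pi.
Proof. exact: reprK. Qed.

Lemma quotmod_piP (u v : V) : quotmod_pi u = quotmod_pi v <-> u - v \in W.
Proof.
rewrite -[u - v \in W]/(u - v \in submod_pred W) Quotient.idealrBE.
by split=> [uv|/eqP //]; apply/eqP.
Qed.

Lemma quotmod_piB : zmod_morphism quotmod_pi.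
Proof. by move=> u v; apply: (@raddfB V (Quotient.quot (submod_pred W)) \pi). Qed.

Let scale (a : T) (x : quotmod W) := quotmod_pi (a *: quotmod_repr x).

Let scale_pi a v : scale a (quotmod_pi v) = quotmod_pi (a *: v).
Proof.
by apply/quotmod_piP; rewrite -scalerBr rpredZ //; apply/quotmod_piP/quotmod_reprK.
Qed.
Let piD u v : quotmod_pi (u + v) = quotmod_pi u + quotmod_pi v.
Proof. exact: (@raddfD V (Quotient.quot (submod_pred W)) \pi). Qed.
Let scaleA a b v : scale a (scale b v) = scale (a * b) v.
Proof. by rewrite -[v]quotmod_reprK !scale_pi scalerA. Qed.
Let scale1 : left_id 1 scale.
Proof. by move=> v; rewrite -[v]quotmod_reprK scale_pi scale1r. Qed.
Let scaleDr : right_distributive scale +%R.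
Proof.
move=> a u v; rewrite -[u]quotmod_reprK -[v]quotmod_reprK.
by rewrite -piD !scale_pi scalerDr piD.
Qed.
Let scaleDl v : {morph scale^~ v : a b / a + b}.
Proof.
by move=> a b; rewrite -[v]quotmod_reprK !scale_pi scalerDl piD.
Qed.
HB.instance Definition _ := GRing.Zmodule_isLmodule.Build T (quotmod W)
  scaleA scale1 scaleDr scaleDl.

Let quotmod_piZ : scalable quotmod_pi.
Proof. by move=> a v; rewrite -scale_pi. Qed.
HB.instance Definition _ :=
  GRing.isZmodMorphism.Build V (quotmod W) quotmod_pi quotmod_piB.
HB.instance Definition _ :=
  GRing.isScalable.Build T V (quotmod W) *:%R quotmod_pi quotmod_piZ.

End Quotients.

Section Submodules.
Variables (T : comNzRingType) (U V : lmodType T) (f : {linear U -> V}).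

Definition ker_pred : {pred U} := fun u => f u == 0.

Let ker_submod : submod_closed ker_pred.
Proof.
split=> [|a u v]; rewrite !unfold_in /= ?linear0 //.
by move=> /eqP fu /eqP fv; rewrite linearP fu fv scaler0 addr0.
Qed.
HB.instance Definition _ := GRing.isSubmodClosed.Build T U ker_pred ker_submod.

Definition kermod : Type := {u : U | u \in ker_pred}.
HB.instance Definition _ := [isSub of kermod for @sval _ _].
HB.instance Definition _ := [Choice of kermod by <:].
HB.instance Definition _ := [SubChoice_isSubLmodule of kermod by <:].

Inductive lin_span (G : V -> Prop) : V -> Prop :=
| lin_span0 : lin_span G 0
| lin_spanD a g v : G g -> lin_span G v -> lin_span G (a *: g + v).

Lemma lin_span_gen (G : V -> Prop) g : G g -> lin_span G g.
Proof.
by move=> Gg; rewrite -[g]scale1r -[_ *: _]addr0; apply: lin_spanD Gg (lin_span0 G).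
Qed.

Definition span_pred (G : V -> Prop) : {pred V} := fun v => `[< lin_span G v >].

Let span_submod G : submod_closed (span_pred G).
Proof.
split=> [|a u v]; first by apply/asboolP; constructor.
move=> /asboolP Gu /asboolP Gv; apply/asboolP.
elim: Gu => [|b g w Gg _ IH]; first by rewrite scaler0 add0r.
by rewrite scalerDr -addrA scalerA; constructor.
Qed.
HB.instance Definition _ (G : V -> Prop) :=
  GRing.isSubmodClosed.Build T V (span_pred G) (span_submod G).

End Submodules.

(* The homology [ker g / im f] at [V] of [U -f-> V -g-> W]. *)
Section Homology.
Variables (T : comNzRingType) (U V W : lmodType T).
Variables (f : {linear U -> V}) (g : {linear V -> W}).

Definition boundary_pred : {pred kermod g} :=
  fun z => `[< exists u, f u = val z >].

Let boundary_submod : submod_closed boundary_pred.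
Proof.
split=> [|a x y].
  by apply/asboolP; exists 0; rewrite linear0 -[RHS]/(val (0 : kermod g)) raddf0.
move=> /asboolP[u fu] /asboolP[v fv]; apply/asboolP; exists (a *: u + v).
by rewrite linearP fu fv linearP.
Qed.
HB.instance Definition _ :=
  GRing.isSubmodClosed.Build T (kermod g) boundary_pred boundary_submod.

Definition homology : lmodType T := quotmod boundary_pred.

End Homology.

Section FreeModules.
Variables (T : comNzRingType) (X : choiceType) (V : lmodType T).

(* The linear map on the free module [{freeg X / T}] extending [h]. *)
Definition free_lift (h : X -> V) : {freeg X / T} -> V := fglift h.

Variable h : X -> V.

Lemma free_liftU a x : free_lift h << a *g x >> = a *: h x.
Proof. exact: liftU. Qed.

Let free_lift_zmod : zmod_morphism (free_lift h).
Proof. exact: lift_is_additive. Qed.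
HB.instance Definition _ :=
  GRing.isZmodMorphism.Build {freeg X / T} V (free_lift h) free_lift_zmod.
Lemma free_liftE D : free_lift h D = \sum_(x <- dom D) coeff x D *: h x.
Proof.
transitivity (free_lift h (\sum_(x <- dom D) << coeff x D *g x >>)).
  by rewrite freeg_sumE.
by rewrite raddf_sum; apply: eq_bigr => x _; rewrite /= free_liftU.
Qed.

Let free_lift_scalable : scalable (free_lift h).
Proof.
move=> a D; rewrite (free_liftE D) scaler_sumr.
rewrite -[LHS]/(free_lift h (fgscale a D)) /fgscale raddf_sum.
by apply: eq_bigr => x _; rewrite /= free_liftU scalerA.
Qed.
HB.instance Definition _ := GRing.isScalable.Build T {freeg X / T} V *:%R
  (free_lift h) free_lift_scalable.

End FreeModules.

Section Tensor.
Variable T : comNzRingType.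

Inductive bilin_rel (M N : lmodType T) : {freeg (M * N)%type / T} -> Prop :=
| bilinDl x y z : bilin_rel (<< (x + y, z) >> - << (x, z) >> - << (y, z) >>)
| bilinDr x y z : bilin_rel (<< (x, y + z) >> - << (x, y) >> - << (x, z) >>)
| bilinZl a x z : bilin_rel (<< (a *: x, z) >> - a *: << (x, z) >>)
| bilinZr a x z : bilin_rel (<< (x, a *: z) >> - a *: << (x, z) >>).

Definition tensor (M N : lmodType T) : lmodType T :=
  quotmod (span_pred (@bilin_rel M N)).

Definition tens (M N : lmodType T) (x : M) (y : N) : tensor M N :=
  quotmod_pi _ << (x, y) >>.

Lemma tensDl (M N : lmodType T) (x y : M) (z : N) :
  tens (x + y) z = tens x z + tens y z.
Proof.
rewrite /tens -linearD; apply/quotmod_piP; apply/asboolP.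
rewrite opprD addrA; apply: lin_span_gen; exact: bilinDl.
Qed.

Lemma tensDr (M N : lmodType T) (x : M) (y z : N) :
  tens x (y + z) = tens x y + tens x z.
Proof.
rewrite /tens -linearD; apply/quotmod_piP; apply/asboolP.
rewrite opprD addrA; apply: lin_span_gen; exact: bilinDr.
Qed.

Lemma tensZl (M N : lmodType T) a (x : M) (z : N) :
  tens (a *: x) z = a *: tens x z.
Proof.
rewrite /tens -linearZ; apply/quotmod_piP; apply/asboolP.
apply: lin_span_gen; exact: bilinZl.
Qed.

Lemma tensZr (M N : lmodType T) a (x : M) (z : N) :
  tens x (a *: z) = a *: tens x z.
Proof.
rewrite /tens -linearZ; apply/quotmod_piP; apply/asboolP.
apply: lin_span_gen; exact: bilinZr.
Qed.

Section TensorMap.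
Variables (M M' : lmodType T) (f : {linear M -> M'}) (N : lmodType T).

(* The map [f (x) N]; it sends [tens x y] to [tens (f x) y], see
   [tensor_map_tens]. *)
Definition tensor_map :
    tensor M N -> tensor M' N :=
  fun t => free_lift (fun xy : M * N => tens (f xy.1) xy.2) (quotmod_repr t).

Local Notation F := (free_lift (fun xy : M * N => tens (f xy.1) xy.2)).

Lemma tensor_map_pi (D : {freeg (M * N)%type / T}) :
  tensor_map (quotmod_pi (span_pred (@bilin_rel M N)) D) = F D.
Proof.
rewrite /tensor_map; set D' := quotmod_repr _.
apply/eqP; rewrite -subr_eq0 -linearB; apply/eqP.
have /asboolP : D' - D \in span_pred (@bilin_rel M N).
  by apply/quotmod_piP; apply: quotmod_reprK.
elim=> [|a g v Gg _ IH]; first by rewrite linear0.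
suff Fg : F g = 0 by rewrite linearP /= IH Fg scaler0 addr0.
have FU x y : F << (x, y) >> = tens (f x) y by rewrite free_liftU scale1r.
case: {a v IH} Gg => [x y z|x y z|a x z|a x z]; rewrite !raddfB /=.
- by rewrite !FU raddfD tensDl -addrA -opprD subrr.
- by rewrite !FU tensDr -addrA -opprD subrr.
- by rewrite linearZ /= !FU linearZ tensZl subrr.
- by rewrite linearZ /= !FU tensZr subrr.
Qed.

Lemma tensor_map_tens x y : tensor_map (tens x y) = tens (f x) y.
Proof. by rewrite tensor_map_pi free_liftU scale1r. Qed.

Let tensor_map_zmod : zmod_morphism tensor_map.
Proof.
move=> s t; rewrite -[s]quotmod_reprK -[t]quotmod_reprK -linearB.
by rewrite !tensor_map_pi linearB.
Qed.
Let tensor_map_scalable : scalable tensor_map.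
Proof.
move=> a s; rewrite -[s]quotmod_reprK -linearZ.
by rewrite !tensor_map_pi linearZ.
Qed.
HB.instance Definition _ := GRing.isZmodMorphism.Build
  (tensor M N) (tensor M' N) tensor_map tensor_map_zmod.
HB.instance Definition _ := GRing.isScalable.Build T
  (tensor M N) (tensor M' N) *:%R tensor_map tensor_map_scalable.

End TensorMap.
End Tensor.

Arguments tensor_map {T M M'} f N.

(* Tor is computed from the standard free resolution
     ... -> F_1 -> F_0 -> M -> 0
   where [F_0] is the free module on the set [M], mapping onto [M], [F_1] is
   the free module on the kernel of this map, and so on. *)
Section Tor.
Variable T : comNzRingType.

Definition augmentation (M : lmodType T) : {linear {freeg M / T} -> M} :=
  free_lift (fun x : M => x).

Fixpoint syzygy (n : nat) (M : lmodType T) : lmodType T :=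
  if n is k.+1 then kermod (augmentation (syzygy k M)) else M.

Definition resolution (n : nat) (M : lmodType T) : lmodType T :=
  {freeg (syzygy n M) / T}.

Definition differential (n : nat) (M : lmodType T) :
    {linear resolution n.+1 M -> resolution n M} :=
  (val : kermod (augmentation (syzygy n M)) -> resolution n M)
    \o augmentation (syzygy n.+1 M).

Lemma augmentation_surj (M : lmodType T) (x : M) :
  exists D, augmentation M D = x.
Proof. by exists << x >>; rewrite /augmentation /= free_liftU scale1r. Qed.

Lemma augmentation_exact (M : lmodType T) (D : resolution 0 M) :
  augmentation M D = 0 <-> exists E, differential 0 M E = D.
Proof.
split=> [D0|[E <-]]; last by apply/eqP; exact: (valP (augmentation (syzygy 1 M) E)).
have DP : D \in ker_pred (augmentation M) by apply/eqP.
have [E ED] := augmentation_surj (exist _ D DP : syzygy 1 M).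
by exists E; rewrite /= ED.
Qed.

Lemma differential_exact n (M : lmodType T) (D : resolution n.+1 M) :
  differential n M D = 0 <-> exists E, differential n.+1 M E = D.
Proof.
split=> [D0|[E ED]].
  by apply: (augmentation_exact (M := syzygy n.+1 M) D).1; apply: val_inj.
have D0 := (augmentation_exact (M := syzygy n.+1 M) D).2 (ex_intro _ E ED).
exact: (congr1 val D0).
Qed.

Definition Tor (i : nat) (M N : lmodType T) : lmodType T :=
  if i is j.+1
  then homology (tensor_map (differential j.+1 M) N)
                (tensor_map (differential j M) N)
  else homology (tensor_map (differential 0 M) N)
                (\0 : {linear tensor (resolution 0 M) N ->
                              tensor (resolution 0 M) N}).

End Tor.

Section Almost.
Variables (K : realType) (T : comNzRingType).
Implicit Types (v : T -> \bar K) (M N : lmodType T).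

(* [v] takes its values in the reals with [+oo] adjoined.  Only [0] has infinite
   value: were [v] allowed to be constantly [+oo], not even the zero module
   would be almost zero. *)
Record value_map v : Prop := ValueMap {
  value_neqNy : forall a, v a != -oo%E;
  value_mul : forall a b, v (a * b) = (v a + v b)%E;
  value_add : forall a b, (Order.min (v a) (v b) <= v (a + b)%R)%E;
  value_eqy : forall a, v a = +oo%E <-> a = 0
}.

Definition almost_zero v M := forall (m : M) (eps : K), 0 < eps ->
  exists b : T, b *: m = 0 /\ (v b < eps%:E)%E.

Definition almost_flat v M := forall (i : nat) N, (0 < i)%N ->
  almost_zero v (Tor i M N).

End Almost.

(* Main.v *)
Require Import Defs.
From HB Require Import structures.
From mathcomp Require Import all_boot all_order all_algebra.
From mathcomp Require Import freeg boolp constructive_ereal reals.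

Set Implicit Arguments.
Unset Strict Implicit.
Unset Printing Implicit Defensive.

Import Order.TTheory GRing.Theory Num.Theory.

Local Open Scope ring_scope.

(** Write [A] for the perfect closure of [R] and [B] for that of [S].

    The proof produces a nonzero [c] in [A] such that multiplication by [c] on
    [B] factors through a finite free [A]-module ([perfect_almost_free]).
    Frobenius is an automorphism of [A] and of [B] that respects the module
    structure, so the factorization can be transported along its inverse: for
    every [n] the [p^n]-th root of [c] has the same property
    ([perfect_almost_free_root]).  An element [c'] for which multiplication by
    [c'] on a module [M] factors through a free module annihilates the higher
    Tor of [M] ([Tor_annihilated]), and the value [v(c) / p^n] of the
    [p^n]-th root of [c] falls below any given positive bound
    ([value_root_small]).

    To find [c], take a family [e] in [B] that is linearly independent over [A]
    and as long as possible.  Its length is at most the number of generators of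
    [S] over [R]: after raising to a power [p^n], which preserves independence
    over the perfect domain [A], the members of an independent family lie in
    [S].  For the same reason one may take [e] in [S].  Let [F] be the
    [A]-span of [e].  The powers [e_i^p] are again independent and as many, so
    some nonzero [d] multiplies the finitely many generators of [S], hence [S]
    itself, into their span.  Taking [p]-th roots, the [p]-th root [r] of [d]
    multiplies every [x] with [x^p] in [S] into [F]; in particular it
    multiplies the [p]-th roots of the [e_i] into [F].  If now
    [r^2 x^p] lies in [F], then [r^(2/p) x] is a combination of the [p]-th
    roots of the [e_i], so [r^(1 + 2/p) x] lies in [F], and so does [r^2 x]
    because [2/p <= 1].  By induction [r^2] multiplies all of [B] into [F], and
    [c = r^2] works.  That [A] is a domain follows from the existence of the
    value map, only [0] having infinite value. *)

(** * Annihilators of Tor *)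

Section Tor.
Variable T : comNzRingType.
Implicit Types U V M N : lmodType T.

Lemma freeg_decomp (X : choiceType) (D : {freeg X / T}) :
  D = \sum_(x <- dom D) coeff x D *: << x >>.
Proof.
rewrite -[LHS]freeg_sumE; apply: eq_bigr => x _.
apply/eqP/freeg_eqP => y; rewrite coeffU -[RHS]/(coeff y (fgscale _ _)).
by rewrite coeff_fgscale coeffU mul1r.
Qed.

(** Free modules are projective; the basis elements are lifted by choice. *)
Lemma free_lifting (X : choiceType) U V (d : {linear U -> V})
    (f : {linear {freeg X / T} -> V}) :
  (forall D, exists E, d E = f D) ->
  exists h : {linear {freeg X / T} -> U}, forall D, d (h D) = f D.
Proof.
move=> ex; pose k x := projT1 (cid (ex << x >>)).
have kE x : d (k x) = f << x >> by rewrite /k; case: cid.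
exists (free_lift k) => D; rewrite /= free_liftE [in RHS](freeg_decomp D) !linear_sum.
by apply: eq_bigr => x _; rewrite !linearZ /= kE.
Qed.

Lemma tensor_ext M N V (f g : {linear tensor M N -> V}) :
  (forall x y, f (tens x y) = g (tens x y)) -> f =1 g.
Proof.
move=> fg t; rewrite -[t]quotmod_reprK (freeg_decomp (quotmod_repr t)) !linear_sum.
by apply: eq_bigr => -[x y] _; rewrite !linearZ /= -/(tens x y) fg.
Qed.

(** The map [mu] is a section, up to the factor [c], of the canonical free cover
    of [M].  Such a map is what a factorization of multiplication by [c] on [M]
    through a free module amounts to, and it plays the role of a contracting
    homotopy in degree [-1]. *)
Variables (M : lmodType T) (c : T) (mu : {linear M -> {freeg M / T}}).
Hypothesis muP : forall x, augmentation M (mu x) = c *: x.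

Lemma homotopy0 : exists h : {linear resolution 0 M -> resolution 1 M},
  forall D, differential 0 M (h D) = c *: D - mu (augmentation M D).
Proof.
pose f : {linear resolution 0 M -> resolution 0 M} :=
  (c \*: idfun) \- (mu \o augmentation M).
apply: (@free_lifting _ _ _ _ f) => D.
by apply/augmentation_exact; rewrite /f /= linearB linearZ /= muP subrr.
Qed.

(** A homotopy from [c] to [0] on the standard resolution in positive degrees,
    built degree by degree.  The statement for [i] alone does not carry the
    induction; what does is that [c - h d] maps to cycles, which by exactness
    lets it be lifted to the next degree. *)
Lemma homotopy i : exists h : {linear resolution i M -> resolution i.+1 M},
  exists h' : {linear resolution i.+1 M -> resolution i.+2 M},
  forall D, differential i.+1 M (h' D) + h (differential i M D) = c *: D.
Proof.
suff : exists h : {linear resolution i M -> resolution i.+1 M}, forall D,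
    differential i M (h (differential i M D)) = c *: differential i M D.
  case=> h hE; exists h.
  pose f : {linear resolution i.+1 M -> resolution i.+1 M} :=
    (c \*: idfun) \- (h \o differential i M).
have fE D : f D = c *: D - h (differential i M D) by [].
  have [|h' h'E] := @free_lifting _ _ _ (differential i.+1 M) f.
    move=> D; apply/differential_exact.
    by rewrite [X in differential i M X]fE linearB linearZ [X in _ - X]hE subrr.
  by exists h' => D; rewrite h'E [X in X + _]fE subrK.
elim: i => [|i [h hE]].
  have [h hE] := homotopy0; exists h => D; rewrite hE.
  have /augmentation_exact -> : exists E, differential 0 M E = differential 0 M D by exists D.
  by rewrite linear0 subr0.
pose f : {linear resolution i.+1 M -> resolution i.+1 M} :=
    (c \*: idfun) \- (h \o differential i M).
have fE D : f D = c *: D - h (differential i M D) by [].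
have [|h' h'E] := @free_lifting _ _ _ (differential i.+1 M) f.
  move=> D; apply/differential_exact.
  by rewrite [X in differential i M X]fE linearB linearZ [X in _ - X]hE subrr.
exists h' => D; rewrite h'E [LHS]fE.
have /differential_exact -> :
  exists E, differential i.+1 M E = differential i.+1 M D by exists D.
by rewrite linear0 subr0.
Qed.

(** The homotopy survives tensoring with [N], so [c] times a cycle is a
    boundary. *)
Lemma Tor_annihilated i N (t : Tor i.+1 M N) : c *: t = 0.
Proof.
have [h [h' hE]] := homotopy i.
rewrite -[t]quotmod_reprK; set z := quotmod_repr t.
rewrite -linearZ -[RHS](linear0 (quotmod_pi _)); apply/quotmod_piP.
rewrite subr0; apply/asboolP; exists (tensor_map h' N (val z)).
have dz : tensor_map (differential i M) N (val z) = 0 by apply/eqP; exact: (valP z).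
rewrite [RHS]linearZ /=.
pose f : {linear tensor (resolution i.+1 M) N -> tensor (resolution i.+1 M) N} :=
  (tensor_map (differential i.+1 M) N \o tensor_map h' N) \+
  (tensor_map h N \o tensor_map (differential i M) N).
pose g : {linear tensor (resolution i.+1 M) N -> tensor (resolution i.+1 M) N} :=
  c \*: idfun.
have fg : f =1 g.
  apply: tensor_ext => x y; rewrite /f /g /=.
  by rewrite !tensor_map_tens -tensDl hE tensZl.
by have := fg (val z); rewrite /f /g /= dz linear0 addr0.
Qed.

End Tor.

(** * Linear dependence over a domain *)

Definition no_zero_divisors (A : comNzRingType) :=
  forall a b : A, a * b = 0 -> a = 0 \/ b = 0.

(** Gaussian elimination without division: rows other than the [k]-th are
    replaced by their combinations with row [k] that vanish in the first
    column. *)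
Lemma dependent_rows (A : comNzRingType) (domA : no_zero_divisors A) m n
    (C : 'I_m -> 'I_n -> A) :
  (n < m)%N ->
  exists b : 'I_m -> A, (exists i, b i <> 0) /\
    forall j, \sum_i b i * C i j = 0.
Proof.
elim: n m C => [|n IH] [//|m] C nm.
  by exists (fun=> 1); split=> [|[]//]; exists ord0; apply/eqP/oner_neq0.
have [C0|] := pselect (forall i, C i ord0 = 0).
  have [|b [b0 bC]] := IH _ (fun i j => C i (fintype.lift ord0 j)); first exact: ltnW.
  exists b; split=> // j; case: (unliftP ord0 j) => [j' ->|->]; first exact: bC.
  by rewrite big1 // => i _; rewrite C0 mulr0.
move=> /existsNP[k Ck].
have [//|b [[i0 bi0] bC]] := IH m (fun i j =>
  C k ord0 * C (fintype.lift k i) (fintype.lift ord0 j) - C (fintype.lift k i) ord0 * C k (fintype.lift ord0 j)).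
exists (fun i => if unlift k i is Some i' then C k ord0 * b i'
                 else - \sum_i' b i' * C (fintype.lift k i') ord0).
split=> [|j].
  by exists (fintype.lift k i0); rewrite fintype.liftK => /domA[].
rewrite (bigD1_ord k) //= unlift_none.
under [X in _ + X]eq_bigr do rewrite fintype.liftK.
rewrite mulNr mulr_suml addrC; apply/eqP; rewrite subr_eq0; apply/eqP.
case: (unliftP ord0 j) => [j' ->|->]; last first.
  by apply: eq_bigr => i _; rewrite -mulrA mulrC.
apply/eqP; rewrite -subr_eq0 -sumrB -[X in _ == X](bC j'); apply/eqP/eq_bigr => i _.
by rewrite mulrBr !mulrA [b i * C k _]mulrC.
Qed.

Section Span.
Variables (A B : comNzRingType) (g : {rmorphism A -> B}).

Definition lincomb h (e : 'I_h -> B) (a : 'I_h -> A) := \sum_i g (a i) * e i.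

Definition independent h (e : 'I_h -> B) :=
  forall a, lincomb e a = 0 -> forall i, a i = 0.

Definition in_span h (e : 'I_h -> B) x := exists a, x = lincomb e a.

Lemma lincombZD h (e : 'I_h -> B) r a b :
  lincomb e (fun i => r * a i + b i) = g r * lincomb e a + lincomb e b.
Proof.
rewrite /lincomb mulr_sumr -big_split; apply: eq_bigr => i _ /=.
by rewrite rmorphD rmorphM mulrDl mulrA.
Qed.

Lemma in_span0 h (e : 'I_h -> B) : in_span e 0.
Proof. by exists (fun=> 0); rewrite /lincomb big1 // => i _; rewrite rmorph0 mul0r. Qed.

Lemma in_spanZD h (e : 'I_h -> B) r x y :
  in_span e x -> in_span e y -> in_span e (g r * x + y).
Proof.
by move=> [a ->] [b ->]; exists (fun i => r * a i + b i); rewrite lincombZD.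
Qed.

Lemma in_spanZ h (e : 'I_h -> B) r x : in_span e x -> in_span e (g r * x).
Proof. by move=> ex; rewrite -[_ * _]addr0; apply: in_spanZD ex (in_span0 e). Qed.

Lemma in_span_lincomb h (e : 'I_h -> B) k (f : 'I_k -> B) a r :
  (forall i, in_span e (g r * f i)) -> in_span e (g r * lincomb f a).
Proof.
move=> ef; rewrite mulr_sumr; apply: big_ind => [|x y ex ey|i _].
- exact: in_span0.
- by rewrite -[x]mul1r -(rmorph1 g); apply: in_spanZD.
- by rewrite mulrCA; apply: in_spanZ.
Qed.

Hypothesis domA : no_zero_divisors A.

Lemma independent_size n (s : 'I_n -> B) h (e : 'I_h -> B) :
  (forall i, in_span s (e i)) -> independent e -> (h <= n)%N.
Proof.
move=> es ind; rewrite leqNgt; apply/negP => nh.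
have [C CE] := choice es.
have [b [[i bi] bC]] := dependent_rows domA C nh.
apply: bi; apply: ind i; rewrite /lincomb.
under eq_bigr do rewrite CE mulr_sumr.
rewrite exchange_big big1 // => j _ /=.
under eq_bigr do rewrite mulrA -rmorphM.
by rewrite -mulr_suml -rmorph_sum bC rmorph0 mul0r.
Qed.

(** In a longest independent family every element of the module is a
    combination of members of the family up to a nonzero factor, since adding
    it to the family creates a relation in which it must occur. *)
Lemma maximal_independent_span h (e : 'I_h -> B) x :
  independent e ->
  (forall k (f : 'I_k -> B), independent f -> (k <= h)%N) ->
  exists2 d, d <> 0 & in_span e (g d * x).
Proof.
move=> ind maxh; pose f (i : 'I_h.+1) := oapp e x (unlift ord0 i).
have fE (a : 'I_h.+1 -> A) :
    lincomb f a = g (a ord0) * x + lincomb e (a \o fintype.lift ord0).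
  rewrite /lincomb big_ord_recl /f unlift_none /=; congr (_ + _).
  by apply: eq_bigr => i _; rewrite fintype.liftK.
have /existsNP[a /not_implyP[fa0 a0]] : ~ independent f.
  by move=> /maxh; rewrite ltnn.
exists (a ord0) => [aE|].
  apply: a0 => i; case: (unliftP ord0 i) => [i' ->|-> //].
  by apply: (ind (a \o fintype.lift ord0)); rewrite -fa0 fE aE rmorph0 mul0r add0r.
exists (fun i => -1 * a (fintype.lift ord0 i) + 0).
rewrite (lincombZD e (-1) (a \o fintype.lift ord0) (fun=> 0)) /=.
rewrite [X in _ + X]big1 => [|i _]; last by rewrite rmorph0 mul0r.
rewrite addr0 rmorphN1 mulN1r; apply/eqP; rewrite -addr_eq0; apply/eqP.
by rewrite -fE.
Qed.

Lemma common_multiple n h (s : 'I_n -> B) (e : 'I_h -> B) :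
  (forall j, exists2 d, d <> 0 & in_span e (g d * s j)) ->
  exists2 d, d <> 0 & forall j, in_span e (g d * s j).
Proof.
move=> sd; have /choice[d dP] : forall j, exists d, d <> 0 /\ in_span e (g d * s j).
  by move=> j; have [d] := sd j; exists d.
exists (\prod_j d j) => [|j].
  apply: (big_ind (fun x : A => x <> 0)) => [|x y x0 y0 /domA[]//|j _].
    exact/eqP/oner_neq0.
  exact: (dP j).1.
by rewrite (bigD1 j) //= [d j * _]mulrC rmorphM -mulrA; apply/in_spanZ/(dP j).2.
Qed.

End Span.

(** * Perfect algebras are almost free *)

Section Perfect.
Variables (p : nat) (A B : comNzRingType) (g : {rmorphism A -> B}).
Hypotheses (domA : no_zero_divisors A) (charB : p \in [pchar B]).
Hypothesis rootA : forall n (a : A), exists b, b ^+ (p ^ n) = a.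
Hypothesis rootB : forall n (x : B), exists y, y ^+ (p ^ n) = x.
Hypothesis frobB : forall n, injective (fun x : B => x ^+ (p ^ n)).

Let frobD n (x y : B) : (x + y) ^+ (p ^ n) = x ^+ (p ^ n) + y ^+ (p ^ n).
Proof.
apply: exprDn_pchar; rewrite (eq_pnat _ (pcharf_eq charB)).
by rewrite pnatX pnat_id // (pcharf_prime charB).
Qed.

Let pn_gt0 n : (0 < p ^ n)%N.
Proof. by rewrite expn_gt0 prime_gt0 // (pcharf_prime charB). Qed.

Lemma lincomb_frob n h (e : 'I_h -> B) a :
  lincomb g e a ^+ (p ^ n) =
  lincomb g (fun i => e i ^+ (p ^ n)) (fun i => a i ^+ (p ^ n)).
Proof.
have f0 : (0 : B) ^+ (p ^ n) = 0 by rewrite expr0n gtn_eqF.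
rewrite /lincomb (big_morph _ (frobD n) f0).
by apply: eq_bigr => i _; rewrite exprMn rmorphXn.
Qed.

Lemma lincomb_frob_inv n h (e : 'I_h -> B) a : exists2 b,
  forall i, b i ^+ (p ^ n) = a i &
  lincomb g (fun i => e i ^+ (p ^ n)) a = lincomb g e b ^+ (p ^ n).
Proof.
have [b bE] := choice (fun i => rootA n (a i)); exists b => //.
by rewrite lincomb_frob; apply: eq_bigr => i _; rewrite bE.
Qed.

(** As [A] is perfect, a relation between the [e_i^(p^n)] is the [p^n]-th power
    of a relation between the [e_i]. *)
Lemma independent_frob n h (e : 'I_h -> B) :
  independent g e -> independent g (fun i => e i ^+ (p ^ n)).
Proof.
move=> ind a; have [b bE ->] := lincomb_frob_inv n e a => b0 i.
have := ind b _ i; rewrite -bE => ->; first by rewrite expr0n gtn_eqF.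
by apply: (frobB (n := n)) => /=; rewrite b0 expr0n gtn_eqF.
Qed.

Lemma domA_expr_eq0 (a : A) k : a ^+ k = 0 -> a = 0.
Proof.
elim: k => [/eqP|k IH]; first by rewrite expr0 oner_eq0.
by rewrite exprS => /domA[].
Qed.

Lemma independent_frobV n h (e : 'I_h -> B) :
  independent g (fun i => e i ^+ (p ^ n)) -> independent g e.
Proof.
move=> ind a a0 i; apply: (@domA_expr_eq0 _ (p ^ n)).
by apply: (ind (fun i => a i ^+ (p ^ n))); rewrite -lincomb_frob a0 expr0n gtn_eqF.
Qed.

Lemma in_span_frobV n h (e : 'I_h -> B) x :
  in_span g (fun i => e i ^+ (p ^ n)) (x ^+ (p ^ n)) -> in_span g e x.
Proof.
case=> a; have [b _ ->] := lincomb_frob_inv n e a => /(@frobB n) xE.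
by exists b.
Qed.

(** In the application [S0] is the image of [S] in its perfect closure [B], and
    [s] lists the images of generators of [S] as an [R]-module. *)
Variables (S0 : B -> Prop) (k : nat) (s : 'I_k -> B).
Hypothesis S0frob : forall n x, S0 x -> S0 (x ^+ (p ^ n)).
Hypothesis S0root : forall x, exists n, S0 (x ^+ (p ^ n)).
Hypothesis S0span : forall x, S0 x -> in_span g s x.

Lemma S0root_family h (e : 'I_h -> B) : exists n, forall i, S0 (e i ^+ (p ^ n)).
Proof.
have [n nE] := choice (fun i => S0root (e i)).
exists (\sum_i n i)%N => i; rewrite (bigD1 i) //= expnD exprM.
exact: S0frob.
Qed.

Lemma rank_bound h (e : 'I_h -> B) : independent g e -> (h <= k)%N.
Proof.
have [n nE] := S0root_family e => /(@independent_frob n).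
by apply: independent_size => // i; apply/S0span/nE.
Qed.

(** Independence is preserved by Frobenius, so a longest family can be moved
    into [S0]. *)
Lemma maximal_independent : exists h (e : 'I_h -> B),
  [/\ independent g e, forall i, S0 (e i) &
      forall l (f : 'I_l -> B), independent g f -> (l <= h)%N].
Proof.
pose P h := `[< exists e : 'I_h -> B, independent g e >].
have P0 : exists h, P h by exists 0%N; apply/asboolP; exists (fun=> 0) => a _ [].
have Pk h : P h -> (h <= k)%N by move=> /asboolP[e /rank_bound].
case: (ex_maxnP P0 Pk) => h /asboolP[e ind] maxh.
have [n nE] := S0root_family e.
exists h, (fun i => e i ^+ (p ^ n)); split=> //; first exact: independent_frob.
by move=> l f indf; apply: maxh; apply/asboolP; exists f.
Qed.

(** One [c] multiplies all of [B] into the free module on [e], although [B] is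
    an infinite union of the modules of [p^n]-th roots of [S0].  The factors
    needed at the successive levels do not accumulate beyond [r ^+ 2]: passing
    from level [n] to level [n + 1] turns [r ^+ 2] into [r] times the square of
    the [p]-th root of [r], which divides [r ^+ 2] as [2 <= p]. *)
Lemma perfect_almost_free : exists2 c : A, c <> 0 &
  exists h (e : 'I_h -> B), independent g e /\ forall x, in_span g e (g c * x).
Proof.
have [h [e [ind Se maxh]]] := maximal_independent.
have [d d0 ds] : exists2 d, d <> 0 & forall j,
    in_span g (fun i => e i ^+ (p ^ 1)) (g d * s j).
  apply: common_multiple => // j; apply: maximal_independent_span => //.
  exact: independent_frob.
have [r rd] := rootA 1 d.
have r0 : r <> 0 by move=> r0; apply: d0; rewrite -rd r0 expr0n gtn_eqF.
have rootS x : S0 (x ^+ (p ^ 1)) -> in_span g e (g r * x).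
  move=> /S0span[a xa]; apply: (@in_span_frobV 1).
  by rewrite exprMn -rmorphXn rd xa; apply: in_span_lincomb.
have r2S n x : S0 (x ^+ (p ^ n)) -> in_span g e (g (r ^+ 2) * x).
  elim: n x => [|n IH] x.
    move=> /(@S0frob 1); rewrite expn0 expr1 => /rootS.
    by rewrite expr2 rmorphM -mulrA; apply: in_spanZ.
  rewrite expnS -{1}(expn1 p) exprM => /IH rx.
  have [t tr] := rootA 1 r.
  have [f fE] := choice (fun i => rootB 1 (e i)).
  have [a xa] : in_span g f (g (t ^+ 2) * x).
    apply: (@in_span_frobV 1); rewrite exprMn -rmorphXn -exprM mulnC exprM tr.
    by have -> : (fun i => f i ^+ (p ^ 1)) = e by apply: funext.
  (* This is where [2 <= p] enters: the exponent [p - 2] is not truncated. *)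
  have -> : r ^+ 2 = t ^+ (p - 2) * r * t ^+ 2.
    rewrite mulrAC -exprD subnK ?prime_gt1 ?(pcharf_prime charB) //.
    by rewrite -{1}(expn1 p) tr expr2.
  rewrite 2!rmorphM -2!mulrA xa.
  apply: in_spanZ.
  by apply: in_span_lincomb => i; apply: rootS; rewrite fE.
exists (r ^+ 2); first by move=> /domA_expr_eq0.
by exists h, e; split=> // x; have [n /r2S] := S0root x.
Qed.

Lemma perfect_almost_free_root : exists2 c : A, c <> 0 & forall n,
  exists2 c', c' ^+ (p ^ n) = c &
  exists h (e : 'I_h -> B), independent g e /\ forall x, in_span g e (g c' * x).
Proof.
have [c c0 [h [e [ind ce]]]] := perfect_almost_free; exists c => // n.
have [c' c'E] := rootA n c; exists c' => //.
have [f fE] := choice (fun i => rootB n (e i)).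
have eE : e = (fun i => f i ^+ (p ^ n)) by apply: funext => i; rewrite fE.
exists h, f; split; first by apply: (@independent_frobV n); rewrite -eE.
by move=> x; apply: (@in_span_frobV n); rewrite -eE exprMn -rmorphXn c'E.
Qed.

End Perfect.

(** The coordinates of [c x] in the independent family [e] depend linearly on
    [x]; placing them on the basis elements [<< e i >>] of the canonical free
    cover of [B] gives a section up to the factor [c]. *)
Lemma almost_free_section (A B : comNzRingType) (g : {rmorphism A -> B}) c h
    (e : 'I_h -> B) :
  independent g e -> (forall x, in_span g e (g c * x)) ->
  exists mu : {linear as_module g -> {freeg (as_module g) / A}},
    forall x, augmentation (as_module g) (mu x) = c *: x.
Proof.
move=> ind /choice[a aE].
have coordE x (b : 'I_h -> A) : lincomb g e b = g c * x -> a x = b.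
  move=> bE; apply: funext => i; apply/eqP; rewrite -subr_eq0; apply/eqP.
  rewrite addrC -mulN1r.
  apply: (ind (fun i => -1 * b i + a x i)).
  by rewrite lincombZD -aE bE rmorphN1 mulN1r addNr.
have coordD r x y : a (g r * x + y) = (fun i => r * a x i + a y i).
  by apply: coordE; rewrite lincombZD -!aE mulrDr mulrCA.
pose mu (x : as_module g) : {freeg (as_module g) / A} :=
  \sum_i a x i *: << (e i : as_module g) >>.
have mulin : linear mu.
  move=> r x y; rewrite /mu scaler_sumr -big_split; apply: eq_bigr => i _ /=.
  by rewrite scalerA -scalerDl [a _](coordD r x y).
pose mul := GRing.isLinear.Build _ _ _ _ mu mulin.
pose muL : {linear as_module g -> {freeg (as_module g) / A}} := HB.pack mu mul.
exists muL => x; rewrite /= /mu linear_sum.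
rewrite [RHS](aE x); apply: eq_bigr => i _.
by rewrite linearZ /= free_liftU scale1r.
Qed.

(** * Value maps *)

Section Values.
Variables (K : realType) (T : comNzRingType) (v : T -> \bar K).
Hypothesis valv : value_map v.

Lemma value_fin a : a <> 0 -> exists r : K, v a = r%:E.
Proof.
move=> a0; case va : (v a) => [r| |]; first by exists r.
  by case: a0; apply/(value_eqy valv).
by have := value_neqNy valv a; rewrite va.
Qed.

Lemma value_no_zero_divisors : no_zero_divisors T.
Proof.
move=> a b ab0; have [->|/eqP/value_fin[r ar]] := eqVneq a 0; first by left.
have [->|/eqP/value_fin[s bs]] := eqVneq b 0; first by right.
by have := (value_eqy valv (a * b)).2 ab0; rewrite (value_mul valv) ar bs.
Qed.

Lemma value_expr a r n : v a = r%:E -> v (a ^+ n) = (r *+ n)%:E.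
Proof.
move=> ar; elim: n => [|n IH]; last first.
  by rewrite exprS (value_mul valv) ar IH -EFinD mulrS.
have [s s1] : exists s : K, v 1 = s%:E by apply: value_fin; exact/eqP/oner_neq0.
have := value_mul valv 1 1; rewrite mulr1 s1 -EFinD => -[] /eqP.
by rewrite -subr_eq0 opprD addrA subrr sub0r oppr_eq0 => /eqP ->.
Qed.

(** A [p^n]-th root of [c] has value [v(c) / p^n], and [p^n] exceeds
    [v(c) / eps] for large [n]. *)
Lemma value_root_small (p : nat) c (eps : K) : (1 < p)%N -> c <> 0 -> 0 < eps ->
  exists n, forall c', c' ^+ (p ^ n) = c -> (v c' < eps%:E)%E.
Proof.
move=> p1 c0 eps0; have [r cr] := value_fin c0.
exists (Num.bound `|r / eps|) => c' c'E; set n := Num.bound _ in c'E *.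
have pn0 : (0 < p ^ n)%N by rewrite expn_gt0 (ltnW p1).
have [s cs] : exists s : K, v c' = s%:E.
  by apply: value_fin => c'0; apply: c0; rewrite -c'E c'0 expr0n gtn_eqF.
rewrite cs lte_fin -(ltr_pMn2r pn0).
have -> : s *+ (p ^ n) = r.
  by have := value_expr (p ^ n) cs; rewrite c'E cr => -[].
rewrite -mulr_natl -ltr_pdivrMr //; apply: le_lt_trans (ler_norm _) _.
apply: lt_trans (archi_boundP (normr_ge0 _)) _.
by rewrite ltr_nat ltn_expl.
Qed.

End Values.

(** * The perfect closures of [R] and [S] *)

Lemma perf_closure_root p (A : comNzRingType) (charA : p \in [pchar A])
    (C : frac_closure A) n (x : perfect_closure charA C) :
  exists y, y ^+ (p ^ n) = x.
Proof.
have [m [a xa]] := perf_root x.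
have [y ya] := perf_has_root charA C (n + m) a.
exists y; apply: (@perf_frobenius_inj _ _ _ _ m) => /=.
by rewrite -exprM -expnD ya xa.
Qed.

Theorem theorem4p6 (K : realType) (p : nat) (R S : comNzRingType)
    (phi : {rmorphism R -> S})
    (regR : regular_local_ring R) (charR : p \in [pchar R])
    (redS : reduced_ring S) (locS : local_ring S)
    (finS : module_finite phi)
    (CR : frac_closure R) (CS : frac_closure S)
    (v : perfect_closure charR CR -> \bar K) (valv : value_map v) :
  almost_flat v (as_module (perf_map phi charR CR CS)).
Proof.
case=> [//|i] N _ t eps eps0.
pose charS := rmorph_pchar phi charR.
pose g := perf_map phi charR CR CS.
have charB := rmorph_pchar g (rmorph_pchar (perf_inj charR CR) charR).
have domA := value_no_zero_divisors valv.
have [s sS] := finS.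
pose S0 x := exists y, x = perf_inj charS CS y.
have S0frob n x : S0 x -> S0 (x ^+ (p ^ n)).
  by case=> y ->; exists (y ^+ (p ^ n)); rewrite rmorphXn.
have S0root x : exists n, S0 (x ^+ (p ^ n)).
  by have [n [y xy]] := perf_root x; exists n, y.
have S0span x : S0 x -> in_span g (fun j : 'I_(size s) => perf_inj charS CS s`_j) x.
  case=> y ->; have [a ->] := sS y; exists (fun j => perf_inj charR CR (a j)).
  rewrite rmorph_sum; apply: eq_bigr => j _.
  by rewrite rmorphM /g perf_map_inj.
have [c c0 cP] := perfect_almost_free_root domA charB
  (@perf_closure_root _ _ _ _) (@perf_closure_root _ _ _ _)
  (@perf_frobenius_inj _ _ _ _) S0frob S0root S0span.
have [n small] := value_root_small valv (prime_gt1 (pcharf_prime charR)) c0 eps0.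
have [c' /small vc' [h [e [ind ce]]]] := cP n.
have [mu muP] := almost_free_section ind ce.
by exists c'; split=> //; apply: (Tor_annihilated muP).
Qed.
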